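(* Let $\mathcal{M}$ be a real Hilbert space (possibly infinite dimensional), let $G:\mathcal{M}\to\mathbb{R}^n$ be a bounded linear operator (the parameter-to-observable map), let $\tilde{\boldsymbol{y}}=(\tilde y_1,\dots,\tilde y_n)^\top\in\mathbb{R}^n$, let $\mathbf{\Sigma}=\mathrm{diag}(\sigma_1^2,\dots,\sigma_n^2)$ with all $\sigma_i>0$, let $\alpha>0$, and let $R:\mathcal{M}\to\mathcal{M}$ be a self-adjoint, strictly positive linear operator. Assume that the operator $G^*\mathbf{\Sigma}^{-1}G+\alpha R$ is boundedly invertible on $\mathcal{M}$. For $\boldsymbol{\theta}_e=(\theta_e^1,\dots,\theta_e^n)^\top\in\mathbb{R}^n$ let $\boldsymbol{y}(\boldsymbol{\theta}_e)\in\mathbb{R}^n$ be the data vector with components $y_i=\tilde y_i(1+\theta_e^i)$, $i=1,\dots,n$, and let $m^\star=m^\star(\boldsymbol{\theta}_e)\in\mathcal{M}$ be the minimizer over $m\in\mathcal{M}$ of $$\hat J(m)=\frac12\|Gm-\boldsymbol{y}(\boldsymbol{\theta}_e)\|_{\mathbf{\Sigma}^{-1}}^2+\frac{\alpha}{2}\|m\|_R^2 .$$ Let $\boldsymbol{\theta}_e$ be a random vector with distribution $N(0,\mathbf{\Sigma})$, so that $m^\star$ is an $\mathcal{M}$-valued random variable. Then $$\mathrm{Tr}\big(\mathrm{Cov}(m^\star)\big)=\sum_{i=1}^n (S^i)^2,$$ where $\mathrm{Cov}(m^\star)$ is the covariance operator of $m^\star$ with respect to the randomness in $\boldsymbol{\theta}_e$,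 and $S^1,\dots,S^n$ are the pointwise sensitivity indices of $m^\star$ with respect to $\boldsymbol{\theta}_e$, computed with the parameter space $\Theta=\mathbb{R}^n$ equipped with the $\mathbf{\Sigma}^{-1}$-weighted norm.
   Context: Weighted norms: $\|z\|_{\mathbf{\Sigma}^{-1}}^2=z^\top\mathbf{\Sigma}^{-1}z$ for $z\in\mathbb{R}^n$, and $\|m\|_R^2=\langle m,Rm\rangle_{\mathcal{M}}$ for $m\in\mathcal{M}$. The adjoint $G^*$ is taken with respect to the inner product of $\mathcal{M}$ and the Euclidean inner product of $\mathbb{R}^n$. Strictly positive means $\langle m,Rm\rangle_{\mathcal{M}}>0$ for all $m\neq0$. Sensitivity operator: $\mathcal{D}:\mathbb{R}^n\to\mathcal{M}$ is the Fréchet derivative, at $\boldsymbol{\theta}_e=0$, of the map $\boldsymbol{\theta}_e\mapsto m^\star(\boldsymbol{\theta}_e)$ sending the parameter to the minimizer of $\hat J$. Equivalently, $\mathcal{D}=-\mathcal{H}^{-1}\mathcal{B}$, where $\mathcal{H}$ is the Hessian of $\hat J$ with respect to $m$ and $\mathcal{B}$ is the Fréchet derivative with respect to $\boldsymbol{\theta}_e$ of the gradient of $\hat J$ with respect to $m$, both evaluated at $\boldsymbol{\theta}_e=0$ and the corresponding minimizer. Pointwise sensitivity indices: with $\boldsymbol{e}_i$ the $i$-th canonical unit vector of $\mathbb{R}^n$, $$S^i=\frac{\|\mathcal{D}\boldsymbol{e}_i\|_{\mathcal{M}}}{\|\boldsymbol{e}_i\|_{\Theta}},\qquad i=1,\dots,n,$$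 where here $\|\cdot\|_\Theta=\|\cdot\|_{\mathbf{\Sigma}^{-1}}$. The covariance operator $\mathrm{Cov}(m^\star):\mathcal{M}\to\mathcal{M}$ is defined by $\langle \mathrm{Cov}(m^\star)u,v\rangle_{\mathcal{M}}=\mathbb{E}\big[\langle m^\star-\mathbb{E}m^\star,u\rangle_{\mathcal{M}}\,\langle m^\star-\mathbb{E}m^\star,v\rangle_{\mathcal{M}}\big]$ for $u,v\in\mathcal{M}$, and $\mathrm{Tr}$ denotes the trace of a linear operator. *)

(* Defs.v *)
From HB Require Import structures.
From mathcomp Require Import all_boot all_order all_algebra.
From mathcomp Require Import all_classical all_reals all_analysis.

Set Implicit Arguments.
Unset Strict Implicit.
Unset Printing Implicit Defensive.

Import Order.TTheory GRing.Theory Num.Theory.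
Import numFieldNormedType.Exports.

Local Open Scope classical_set_scope.
Local Open Scope ring_scope.

Section InnerProduct.
Context {R : realType} {M : completeNormedModType R}.
Implicit Type dot : {dot M for idfun}.

(* M together with [dot] is a real Hilbert space: M is complete for its norm. *)
Definition is_inner_product dot := forall u, `|u| ^+ 2 = dot u u.

Definition self_adjoint dot (A : M -> M) := forall u v, dot (A u) v = dot u (A v).

Definition strictly_positive dot (A : M -> M) := forall u, u != 0 -> 0 < dot u (A u).

(* [Gs] is the adjoint of [G] for [dot] and the Euclidean inner product. *)
Definition is_adjoint dot n (G : M -> 'cV[R]_n) (Gs : 'cV[R]_n -> M) :=
  forall m z, dot m (Gs z) = ((G m)^T *m z) 0 0.

Definition orthonormal_set dot (B : set M) :=
  (forall b, B b -> dot b b = 1) /\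
  (forall b c, B b -> B c -> b != c -> dot b c = 0).

(* Orthonormal basis in the Hilbert sense, of arbitrary cardinality. *)
Definition orthonormal_basis dot (B : set M) :=
  orthonormal_set dot B /\ forall u, (forall b, B b -> dot u b = 0) -> u = 0.

(* [A] is trace class with trace [t]: the diagonal series converges absolutely
   and sums to [t] in every orthonormal basis. *)
Definition has_trace dot (A : M -> M) (t : R) :=
  forall B, orthonormal_basis dot B ->
    let a b := (dot (A b) b)%:E in
    summable B a /\
    (\esum_(b in B) (a^\+)%E b - \esum_(b in B) (a^\-)%E b)%E = t%:E.

Lemma dot_eq0 dot u : dot u u = 0 -> u = 0.
Proof.
move=> u0; apply/eqP; apply: contraT => /(neq0_dnorm_gt0 (s:=dot)).
by rewrite u0 ltxx.
Qed.

Lemma dotB dot u v w : dot (u - v) w = dot u w - dot v w.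
Proof. exact: linearBl. Qed.

Lemma dotC dot u v : dot u v = dot v u.
Proof. by rewrite (hermitian_subproof (s:=dot)) expr0 mul1r. Qed.

Lemma dotZl dot a u v : dot (a *: u) v = a * dot u v.
Proof. exact: linearZl_LR. Qed.

Lemma dotZr dot a u v : dot u (a *: v) = a * dot u v.
Proof. by rewrite dotC dotZl dotC. Qed.

Lemma dot_inj dot u v : (forall w, dot u w = dot v w) -> u = v.
Proof.
move=> uv; apply/eqP; rewrite -subr_eq0; apply/eqP/(@dot_eq0 dot).
by rewrite dotB uv subrr.
Qed.

Lemma orthonormal_basis_exists dot : exists B, orthonormal_basis dot B.
Proof.
have [F FP Ftot|B [oB maxB]] := @Zorn_bigcup M (orthonormal_set dot).
  split=> [b [X FX Xb]|b c [X FX Xb] [Y FY Yc] bc].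
    exact: (FP X FX).1.
  have [XY|YX] := Ftot X Y FX FY.
    by apply: (FP Y FY).2 => //; exact: XY.
  by apply: (FP X FX).2 => //; exact: YX.
exists B; split=> // u uB; apply: contrapT => /eqP u0.
have uu : 0 < dot u u by exact: neq0_dnorm_gt0.
pose v := (Num.sqrt (dot u u))^-1 *: u.
have vv : dot v v = 1.
  rewrite dotZl dotZr mulrA -invfM -expr2 sqr_sqrtr ?ltW// mulVf//.
  by rewrite gt_eqF.
have vB b : B b -> dot v b = 0.
  by move=> Bb; rewrite /v dotZl (uB b Bb) mulr0.
apply: (maxB (B `|` [set v])).
  split; first by move=> x; left.
  move=> /(_ v) Bv; have {}Bv : B v by apply: Bv; right.
  by move: vv; rewrite vB// => /esym/eqP; rewrite oner_eq0.
split=> [b [Bb|->//]|b c [Bb|->] [Bc|->]].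
- exact: oB.1.
- exact: oB.2.
- by move=> _; rewrite dotC; exact: vB.
- by move=> _; exact: vB.
- by rewrite eqxx.
Qed.

Lemma has_trace_unique dot (A : M -> M) s t :
  has_trace dot A s -> has_trace dot A t -> s = t.
Proof.
have [B oB] := orthonormal_basis_exists dot.
by move=> /(_ B oB)[_ As] /(_ B oB)[_]; rewrite As => -[].
Qed.

End InnerProduct.

Definition bounded_linear (R : realType) (U V : normedModType R) (f : U -> V) :=
  linear f /\ exists k : R, forall u, `|f u| <= k * `|u|.

Definition boundedly_invertible (R : realType) (U : normedModType R)
    (A : U -> U) :=
  exists K : U -> U, [/\ bounded_linear K, cancel A K & cancel K A].

Definition is_minimizer (R : realType) (T : Type) (J : T -> R) (x : T) :=
  forall y, J x <= J y.

Definition argmin (R : realType) (T : pointedType) (J : T -> R) : T :=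
  get (is_minimizer J).

Section RandomElements.
Context {R : realType} {d : measure_display} {Omega : measurableType d}.
Variable P : probability Omega R.

(* Law N(m, v) on the line, with variance [v]. The case [v = 0] is separate
   since [normal_prob m 0] is not the Dirac mass at [m]. *)
Definition normal_law (m v : R) (A : set R) : \bar R :=
  if v == 0 then \d_m A else normal_prob m (Num.sqrt v) A.

(* X ~ N(mu, S): every linear combination a^T X has law N(a^T mu, a^T S a). *)
Definition multivariate_normal n (X : Omega -> 'cV[R]_n)
    (mu : 'cV[R]_n) (S : 'M[R]_n) :=
  (forall i, measurable_fun setT (fun w => X w i 0)) /\
  forall (a : 'cV[R]_n) (A : set R), measurable A ->
    P ((fun w => (a^T *m X w) 0 0) @^-1` A) =
    normal_law ((a^T *m mu) 0 0) ((a^T *m S *m a) 0 0) A.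

Context {M : completeNormedModType R}.
Variable dot : {dot M for idfun}.

(* Weak (Pettis) expectation of an M-valued random element. *)
Definition is_mean (X : Omega -> M) (mbar : M) :=
  forall u, P.-integrable setT (fun w => (dot (X w) u)%:E) /\
    'E_P[fun w => dot (X w) u]%E = (dot mbar u)%:E.

Definition is_covariance (X : Omega -> M) (C : M -> M) :=
  exists2 mbar, is_mean X mbar & forall u v,
    let f w := dot (X w - mbar) u * dot (X w - mbar) v in
    P.-integrable setT (fun w => (f w)%:E) /\ (dot (C u) v)%:E = 'E_P[f]%E.

Lemma is_mean_unique X m1 m2 : is_mean X m1 -> is_mean X m2 -> m1 = m2.
Proof.
move=> X1 X2; apply: (@dot_inj _ _ dot) => u.
by have [_ ] := X1 u; have [_ ->] := X2 u; case.
Qed.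

Lemma is_covariance_unique X C1 C2 :
  is_covariance X C1 -> is_covariance X C2 -> C1 = C2.
Proof.
move=> [m1 X1 XC1] [m2 X2 XC2]; rewrite -(is_mean_unique X1 X2) in XC2.
apply/funext => u; apply: (@dot_inj _ _ dot) => v.
by have [_ ] := XC1 u v; have [_ <-] := XC2 u v; case.
Qed.

End RandomElements.

Section InverseProblem.
Context {R : realType} {M : completeNormedModType R} {n : nat}.
Variable dot : {dot M for idfun}.
Variables (G : M -> 'cV[R]_n) (Reg : M -> M).
Variables (ytilde : 'cV[R]_n) (sigma : 'I_n -> R) (alpha : R).

Definition noise_cov : 'M[R]_n := diag_mx (\row_i sigma i ^+ 2).

Definition sqr_wnorm (z : 'cV[R]_n) : R := (z^T *m invmx noise_cov *m z) 0 0.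

Definition data (theta : 'cV[R]_n) : 'cV[R]_n :=
  \col_i (ytilde i 0 * (1 + theta i 0)).

Definition Jhat (theta : 'cV[R]_n) (m : M) : R :=
  2^-1 * sqr_wnorm (G m - data theta) + alpha / 2 * dot m (Reg m).

Definition mstar (theta : 'cV[R]_n) : M := argmin (Jhat theta).

Definition normal_operator (Gs : 'cV[R]_n -> M) (m : M) : M :=
  Gs (invmx noise_cov *m G m) + alpha *: Reg m.

Definition sensitivity : 'cV[R]_n -> M := 'd mstar 0.

Definition sensitivity_index (i : 'I_n) : R :=
  let e_i : 'cV[R]_n := delta_mx i 0 in
  `|sensitivity e_i| / Num.sqrt (sqr_wnorm e_i).

End InverseProblem.

(* Main.v *)
From HB Require Import structures.
Require Import Defs.
From mathcomp Require Import all_boot all_order all_algebra.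
From mathcomp Require Import all_classical all_reals all_analysis.
From mathcomp Require Import ring lra measurable_realfun.

Import Order.TTheory GRing.Theory Num.Theory.
Import numFieldNormedType.Exports.

Local Open Scope classical_set_scope.
Local Open Scope ring_scope.

(** The functional [Jhat t] is a strictly convex quadratic, so its minimizer is
    the solution of the normal equation and is an affine function of [t], say
    [m0 + \sum_i t i 0 *: d i]; hence the sensitivity operator sends the [i]-th unit
    vector to [d i], and the [i]-th index is [sigma i * `|d i|].  As the noise
    components are uncorrelated with variances [sigma i ^+ 2], the covariance of
    the minimizer is the finite-rank operator
    [u |-> \sum_i dot (sigma i *: d i) u *: (sigma i *: d i)],
    whose trace is [\sum_i `|sigma i *: d i| ^+ 2] by Parseval's identity. *)

Set Implicit Arguments.
Unset Strict Implicit.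

(** * Second moment of a centred normal distribution on the line *)

Section normal_second_moment.
Context {R : realType}.
Notation mu := (@lebesgue_measure R).
Implicit Types (m s x : R).

Lemma is_derive_normal_pdf s x : s != 0 ->
  is_derive x 1 (normal_pdf 0 s) (- (x / s ^+ 2) * normal_pdf 0 s x).
Proof.
move=> s0; rewrite normal_pdfE// /normal_fun.
apply: is_derive_eq.
rewrite /GRing.scale/= !subr0.
by field.
Qed.

(** From [1 + y <= expR y] at [y = x ^+ 2 / (2 * s ^+ 2)] comes [expR (- y) <= y^-1], so the product
    is squeezed between 0 and a constant multiple of [x^-1]. *)
Lemma cvg_mul_normal_pdf s : s != 0 ->
  x * normal_pdf 0 s x @[x --> +oo] --> (0 : R).
Proof.
move=> s0; have s2 : 0 < s ^+ 2 by rewrite exprn_even_gt0.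
have inv0 : (2 * s ^+ 2 * normal_peak s) * x^-1 @[x --> +oo] --> (0 : R).
  rewrite -[X in _ --> X](mulr0 (2 * s ^+ 2 * normal_peak s)).
  apply: cvgM; first exact: cvg_cst.
  apply/gtr0_cvgV0; last exact: cvg_id.
  exact: nbhs_pinfty_gt.
apply: (squeeze_cvgr _ (cvg_cst (0 : R)) inv0).
near=> x.
have x0 : 0 < x by near: x; exact: nbhs_pinfty_gt.
rewrite (mulr_ge0 (ltW x0)) ?normal_pdf_ge0//=.
rewrite normal_pdfE// mulrCA [leRHS]mulrAC [leRHS]mulrC.
rewrite ler_wpM2l ?normal_peak_ge0// /normal_fun subr0 mulNr expRN.
rewrite ler_pdivrMr ?expR_gt0//.
have := expR_ge1Dx (x ^+ 2 / (s ^+ 2 *+ 2)); set e := expR _ => He.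
have : x ^+ 2 / (s ^+ 2 *+ 2) <= e by lra.
rewrite ler_pdivrMr ?pmulrn_lgt0// => H.
rewrite mulrAC ler_pdivlMr// -expr2 (le_trans H)// le_eqVlt; apply/orP; left.
by apply/eqP; ring.
Unshelve. all: by end_near. Qed.

(** The functions [x ^+ 2 * p x] and [s ^+ 2 * p x] differ by the derivative of
    [- s ^+ 2 * (x * p x)], which vanishes at 0 and at infinity, so their integrals over the
    half-line agree. Evenness extends this to the whole line, where [p] has mass 1. *)
Lemma integral_sqr_normal_pdf s : 0 < s ->
  (\int[mu]_x (x ^+ 2 * normal_pdf 0 s x)%:E = (s ^+ 2)%:E)%E.
Proof.
move=> s0; have sN0 : s != 0 by rewrite gt_eqF.
set p := normal_pdf 0 s.
have p0 x : 0 <= p x by exact: normal_pdf_ge0.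
have cp : continuous p by exact: continuous_normal_pdf.
have cxp : continuous (fun x => x ^+ 2 * p x).
  by move=> x; apply: cvgM; [exact: exprn_continuous|exact: cp].
have csp : continuous (fun x => s ^+ 2 * p x).
  by move=> x; apply: cvgM; [exact: cvg_cst|exact: cp].
have mc (f : R -> R) (D : set R) : continuous f -> measurable_fun D f.
  by move=> cf; apply: measurable_funTS; exact: continuous_measurable_fun.
(* [F' x = (x ^+ 2 - s ^+ 2) * p x] has a constant sign on each side of [s], so
   the fundamental theorem applies separately on [0, s] and on [s, +oo[. *)
pose F x := - s ^+ 2 * (x * p x).
have dF x : is_derive x 1 F ((x ^+ 2 - s ^+ 2) * p x).
  have dp := is_derive_normal_pdf x sN0; rewrite /F.
  by apply: is_derive_eq; rewrite /GRing.scale/= -/p; field.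
have cF : continuous F.
  by move=> x; apply: differentiable_continuous; apply/derivable1_diffP.
have outer : (\int[mu]_(x in `[s, +oo[) ((x ^+ 2 - s ^+ 2) * p x)%:E =
    (- F s)%:E)%E.
  rewrite (@ge0_continuous_FTC2y _ _ F _ 0) ?sub0e//.
  - move=> x sx; rewrite mulr_ge0// subr_ge0 lerXn2r ?nnegrE ?(le_trans (ltW s0))// ltW.
  - apply: continuous_subspaceT => x.
    by apply: cvgM; [apply: cvgB; [exact: exprn_continuous|exact: cvg_cst]|exact: cp].
  - rewrite /F -[X in _ --> X](mulr0 (- s ^+ 2)).
    by apply: cvgM; [exact: cvg_cst|exact: cvg_mul_normal_pdf].
  - by apply: cvg_at_right_filter; exact: cF.
  - by move=> x _; rewrite derive1E; exact: derive_val.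
have inner : (\int[mu]_(x in `[0%R, s]) ((s ^+ 2 - x ^+ 2) * p x)%:E =
    (- F s)%:E)%E.
  have F0 : F 0 = 0 by rewrite /F mul0r mulr0.
  rewrite (@continuous_FTC2 _ _ (\- F) _ _ s0) ?F0 ?oppr0 ?sube0//=.
  - by rewrite F0 oppr0 sube0.
  - apply: continuous_subspaceT => x.
    by apply: cvgM; [apply: cvgB; [exact: cvg_cst|exact: exprn_continuous]|exact: cp].
  - split.
    + by move=> x _; apply: derivableN.
    + by apply: cvg_at_right_filter; apply: continuousN; exact: cF.
    + by apply: cvg_at_left_filter; apply: continuousN; exact: cF.
  - move=> x _; rewrite derive1E deriveN// derive_val; ring.
have eq0y (f : R -> R) : continuous f -> (forall x, 0 <= f x) ->
   (\int[mu]_(x in `[0%R, +oo[) (f x)%:E = \int[mu]_(x in `[0%R, s]) (f x)%:E +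
    \int[mu]_(x in `[s, +oo[) (f x)%:E)%E.
  move=> cf f0.
  (* Dropping the endpoint [s] from the second interval makes the two pieces disjoint. *)
  rewrite -[X in (_ + X)%E]integral_itv_obnd_cbnd; last first.
    by apply/measurable_EFinP; exact: mc.
  rewrite -ge0_integral_setU//=.
  - by rewrite -itv_bndbnd_setU// ?bnd_simp// ltW.
  - by apply/measurable_EFinP; exact: mc.
  - by move=> x _; rewrite lee_fin.
  - apply/disj_setPS => x [] /=; rewrite !in_itv/= andbT => /andP[_ xs].
    by rewrite ltNge xs.
have half : (\int[mu]_(x in `[0%R, +oo[) (x ^+ 2 * p x)%:E =
   \int[mu]_(x in `[0%R, +oo[) (s ^+ 2 * p x)%:E)%E.
  rewrite eq0y// ?eq0y//; last 2 first.
  - by move=> x; rewrite mulr_ge0// sqr_ge0.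
  - by move=> x; rewrite mulr_ge0// sqr_ge0.
  (* On each piece the two integrals differ by the same [- F s], once in each direction. Both
     relations are stated as sums of nonnegative terms, so that no extended real is subtracted. *)
  have -> : (\int[mu]_(x in `[s, +oo[) (x ^+ 2 * p x)%:E =
      (- F s)%:E + \int[mu]_(x in `[s, +oo[) (s ^+ 2 * p x)%:E)%E.
    rewrite -outer -ge0_integralD//=.
    - by apply: eq_integral => x _; rewrite -EFinD; congr EFin; ring.
    - move=> x; rewrite in_itv/= andbT => sx; rewrite lee_fin mulr_ge0//.
      by rewrite subr_ge0 lerXn2r ?nnegrE ?(le_trans (ltW s0))// ltW.
    - apply/measurable_EFinP; apply: mc => x.
      by apply: cvgM; [apply: cvgB; [exact: exprn_continuous|exact: cvg_cst]|exact: cp].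
    - by move=> x _; rewrite lee_fin mulr_ge0// sqr_ge0.
    - by apply/measurable_EFinP; apply: mc.
  have -> : (\int[mu]_(x in `[0%R, s]) (s ^+ 2 * p x)%:E =
      (- F s)%:E + \int[mu]_(x in `[0%R, s]) (x ^+ 2 * p x)%:E)%E.
    rewrite -inner -ge0_integralD//=.
    - by apply: eq_integral => x _; rewrite -EFinD; congr EFin; ring.
    - move=> x; rewrite in_itv/= => /andP[x0 xs]; rewrite lee_fin mulr_ge0//.
      by rewrite subr_ge0 lerXn2r ?nnegrE// ltW.
    - apply/measurable_EFinP; apply: mc => x.
      by apply: cvgM; [apply: cvgB; [exact: cvg_cst|exact: exprn_continuous]|exact: cp].
    - by move=> x _; rewrite lee_fin mulr_ge0// sqr_ge0.
    - by apply/measurable_EFinP; apply: mc.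
  by rewrite addeA (addeC (- F s)%:E).
have pN x : p (- x) = p x by rewrite /p normal_pdfE// /normal_fun !subr0 sqrrN.
rewrite ge0_symfun_integralT//; last 2 first.
- by move=> x; rewrite mulr_ge0// sqr_ge0.
- by move=> x /=; rewrite pN sqrrN.
rewrite -set_itvcy half set_itvcy -ge0_symfun_integralT//; last 2 first.
- by move=> x; rewrite mulr_ge0// sqr_ge0.
- by move=> x /=; rewrite pN.
under eq_integral do rewrite EFinM.
rewrite ge0_integralZl//=; last 3 first.
- by apply/measurable_EFinP; exact: measurable_normal_pdf.
- by move=> x _; rewrite lee_fin.
- by rewrite lee_fin sqr_ge0.
by rewrite integral_normal_pdf mule1.
Qed.

(** The Radon-Nikodym derivative of [normal_prob m s] and [normal_pdf m s] have the same integral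
    over every measurable set, hence agree almost everywhere. *)
Lemma ge0_integral_normal_prob m s (f : R -> R) :
  measurable_fun setT f -> (forall x, 0 <= f x) ->
  (\int[normal_prob m s]_x (f x)%:E = \int[mu]_x (f x * normal_pdf m s x)%:E)%E.
Proof.
move=> mf f0; have dom := normal_prob_dominates m s.
have mfE : measurable_fun setT (EFin \o f) by exact/measurable_EFinP.
have mpE : measurable_fun setT (EFin \o normal_pdf m s).
  by apply/measurable_EFinP; exact: measurable_normal_pdf.
rewrite -(Radon_Nikodym_SigmaFinite.change_of_variables dom)//=.
have mdE := measurable_int _ (Radon_Nikodym_SigmaFinite.f_integrable dom).
under [RHS]eq_integral do rewrite EFinM.
apply: ae_eq_integral => //.
- exact: emeasurable_funM.
- exact: emeasurable_funM.
- apply: ae_eqe_mul2l; apply: integral_ae_eq => //.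
    exact: Radon_Nikodym_SigmaFinite.f_integrable.
  by move=> A _ mA; rewrite -Radon_Nikodym_SigmaFinite.f_integral.
Qed.

Lemma integral_sqr_normal_prob s : 0 < s ->
  (\int[normal_prob 0 s]_x (x ^+ 2)%:E = (s ^+ 2)%:E)%E.
Proof.
move=> s0; rewrite ge0_integral_normal_prob ?integral_sqr_normal_pdf//.
by move=> x; exact: sqr_ge0.
Qed.

End normal_second_moment.

(** * Moments of a real random variable determined by its law *)

Section normal_law.
Context {R : realType} {d : measure_display} {Omega : measurableType d}.
Context (P : probability Omega R).
Implicit Types (X Y : Omega -> R) (v : R).

(** The integral is transported to the law of [X]. The Dirac case [v = 0] does occur later, for
    instance for the zero linear form. *)
Lemma second_moment_normal_law X v : measurable_fun setT X -> 0 <= v ->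
  (forall A, measurable A -> P (X @^-1` A) = normal_law 0 v A) ->
  (\int[P]_w (X w ^+ 2)%:E = v%:E)%E.
Proof.
move=> mX v0 hX.
have msq : measurable_fun [set: measurableTypeR R] (fun x => ((x : R) ^+ 2)%:E).
  exact/measurable_EFinP.
transitivity (\int[pushforward P (X : Omega -> measurableTypeR R)]_x ((x : R) ^+ 2)%:E)%E.
  rewrite ge0_integral_pushforward//= => x _.
  by rewrite lee_fin sqr_ge0.
move: hX; rewrite /normal_law; have [->|vN0] := eqVneq v 0 => hX.
  rewrite (eq_measure_integral (\d_(0 : measurableTypeR R))) => [|A mA _]; last exact: hX.
  by rewrite integral_dirac//= expr0n/= mule0.
rewrite (eq_measure_integral (normal_prob 0 (Num.sqrt v))) => [|A mA _]; last exact: hX.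
by rewrite integral_sqr_normal_prob ?sqr_sqrtr// sqrtr_gt0 lt_def vN0.
Qed.

Lemma eq_law_integral X Y : measurable_fun setT X -> measurable_fun setT Y ->
  P.-integrable setT (EFin \o X) -> P.-integrable setT (EFin \o Y) ->
  (forall A, measurable A -> P (X @^-1` A) = P (Y @^-1` A)) ->
  (\int[P]_w (X w)%:E = \int[P]_w (Y w)%:E)%E.
Proof.
move=> mX mY iX iY XY.
have mE : measurable_fun setT (@EFin R) by exact/measurable_EFinP.
have pf Z : measurable_fun setT Z -> P.-integrable setT (EFin \o Z) ->
    (\int[P]_w (Z w)%:E = \int[pushforward P Z]_x x%:E)%E.
  by move=> mZ iZ; rewrite integral_pushforward.
rewrite !pf//; apply: eq_measure_integral => A mA _; exact: XY.
Qed.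

(** A probability is finite, so [1 + X ^+ 2] is integrable; it dominates [|X|] because
    [(t - 2^-1) ^+ 2 >= 0]. *)
Lemma integrable_sqr_integrable X : measurable_fun setT X ->
  P.-integrable setT (EFin \o (fun w => X w ^+ 2)) -> P.-integrable setT (EFin \o X).
Proof.
move=> mX iX.
have i1 : P.-integrable setT (EFin \o (fun w => 1 + X w ^+ 2)).
  rewrite (_ : EFin \o _ = cst 1%E \+ (EFin \o (fun w => (X w ^+ 2)%R)))%E//.
  apply: integrableD => //; exact: finite_measure_integrable_cst.
apply: (le_integrable _ _ _ i1) => //; first exact/measurable_EFinP.
move=> w _ /=; rewrite lee_fin -(real_normK (num_real (X w))).
rewrite (ger0_norm (addr_ge0 ler01 (sqr_ge0 _))); move: `|X w| => t.
by have := sqr_ge0 (t - 2^-1); rewrite !expr2; lra.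
Qed.

End normal_law.

(** * First and second moments of linear forms in a Gaussian vector *)

Section multivariate_normal.
Context {R : realType} {d : measure_display} {Omega : measurableType d}.
Context (P : probability Omega R) (n : nat).
Context (X : Omega -> 'cV[R]_n) (S : 'M[R]_n).
Context (hX : multivariate_normal P X 0 S).
Context (S_ge0 : forall a : 'cV[R]_n, 0 <= (a^T *m S *m a) 0 0).
Implicit Types a b : 'cV[R]_n.

Let L a w := (a^T *m X w) 0 0.

Let LD a b w : L (a + b) w = L a w + L b w.
Proof. by rewrite /L linearD/= mulmxDl mxE. Qed.

Let LN a w : L (- a) w = - L a w.
Proof. by rewrite /L linearN/= mulNmx mxE. Qed.

Let mL a : measurable_fun setT (L a).
Proof.
rewrite (_ : L a = fun w => \sum_i a i 0 * X w i 0); last first.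
  by apply/funext => w; rewrite /L mxE; apply: eq_bigr => i _; rewrite mxE.
apply: measurable_sum => i; apply: measurable_funM => //.
by case: hX.
Qed.

Let lawL a A : measurable A -> P (L a @^-1` A) = normal_law 0 ((a^T *m S *m a) 0 0) A.
Proof. by move=> mA; case: hX => _ /(_ a A mA); rewrite mulmx0 mxE. Qed.

Let sqrL a : (\int[P]_w (L a w ^+ 2)%:E = ((a^T *m S *m a) 0 0)%:E)%E.
Proof. by apply: second_moment_normal_law => // A; exact: lawL. Qed.

Let integrable_sqrL a : P.-integrable setT (EFin \o (fun w => L a w ^+ 2)).
Proof.
apply/integrableP; split; first exact/measurable_EFinP/measurable_funX.
under eq_integral do rewrite /= ger0_norm ?sqr_ge0//.
by rewrite sqrL ltry.
Qed.

Lemma integrable_normal_form a :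
  P.-integrable setT (fun w => ((a^T *m X w) 0 0)%:E).
Proof. exact: (integrable_sqr_integrable (mL a) (integrable_sqrL a)). Qed.

(* The forms [a] and [- a] have the same law. *)
Lemma expectation_normal_form a : (\int[P]_w ((a^T *m X w) 0 0)%:E = 0)%E.
Proof.
have : (\int[P]_w (L a w)%:E = \int[P]_w (L (- a) w)%:E)%E.
  apply: eq_law_integral => //; [exact: integrable_normal_form..|] => A mA.
  have qN : (- a)^T *m S *m (- a) = a^T *m S *m a.
    by rewrite [(- a)^T]linearN !mulNmx mulmxN opprK.
  by rewrite (lawL a mA) (lawL (- a) mA) qN.
under [X in _ = X]eq_integral do rewrite LN EFinN.
rewrite integralN/=; last first.
  exact/integrable_add_def/integrable_normal_form.
have /fin_numP := integrable_fin_num measurableT (integrable_normal_form a).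
rewrite -/(L a); case: (integral _ _ _) => [r||] [] // _ _ [] /eqP.
by rewrite -addr_eq0 -mulr2n mulrn_eq0/= => /eqP ->.
Qed.

(** The hypothesis on [X] only gives the laws of single linear forms; polarization reduces mixed
    moments to squares of such forms. *)
Let mul_polar a b w : L a w * L b w = 4^-1 * (L (a + b) w ^+ 2 - L (a - b) w ^+ 2).
Proof. by rewrite !LD LN; field. Qed.

Lemma integrable_mul_normal_form a b :
  P.-integrable setT (fun w => ((a^T *m X w) 0 0 * (b^T *m X w) 0 0)%:E).
Proof.
rewrite (_ : (fun w => _) = (fun w => 4^-1%:E *
    ((EFin \o (fun w => L (a + b) w ^+ 2)%R) \-
     (EFin \o (fun w => L (a - b) w ^+ 2)%R)) w))%E.
  by apply: integrableZl => //; apply: integrableB => //.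
by apply/funext => w; rewrite -!/(L _ w) mul_polar.
Qed.

Lemma expectation_mul_normal_form a b : S^T = S ->
  (\int[P]_w ((a^T *m X w) 0 0 * (b^T *m X w) 0 0)%:E = ((a^T *m S *m b) 0 0)%:E)%E.
Proof.
move=> SS.
under eq_integral do rewrite -!/(L _ _) mul_polar EFinM EFinB.
rewrite integralZl//=; last first.
  exact: (integrableB measurableT (integrable_sqrL _) (integrable_sqrL _)).
rewrite (integralB measurableT (integrable_sqrL _) (integrable_sqrL _)) !sqrL.
rewrite -EFinB -EFinM; congr EFin.
(* Polarization recovers only the symmetric part of the bilinear form of [S], whence the use of
   [S^T = S]. *)
have sym : (b^T *m S *m a) 0 0 = (a^T *m S *m b) 0 0.
  by rewrite -[in LHS](trmxK (b^T *m S *m a)) mxE !trmx_mul trmxK SS mulmxA.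
rewrite [(a + b)^T]linearD [(a - b)^T]linearB !(mulmxDl, mulmxDr, mulNmx, mulmxN).
have E (x y : 'M[R]_1) : (x + y) 0 0 = x 0 0 + y 0 0 by rewrite mxE.
have N (x : 'M[R]_1) : (- x) 0 0 = - x 0 0 by rewrite mxE.
by rewrite !(E, N) sym; field.
Qed.

End multivariate_normal.

(** * Parseval's identity and the trace of finite-rank operators *)

Section InnerProductTheory.
Context {R : realType} {M : completeNormedModType R} (dot : {dot M for idfun}).
Implicit Types (u v w : M) (F : seq M).

Lemma dotDl u v w : dot (u + v) w = dot u w + dot v w.
Proof. exact: linearDl. Qed.

Lemma dotDr u v w : dot w (u + v) = dot w u + dot w v.
Proof. by rewrite !(dotC dot w) dotDl. Qed.

Lemma dotBr u v w : dot w (u - v) = dot w u - dot w v.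
Proof. by rewrite !(dotC dot w) dotB. Qed.

Lemma dot_suml (I : Type) (r : seq I) (Q : pred I) (E : I -> M) w :
  dot (\sum_(i <- r | Q i) E i) w = \sum_(i <- r | Q i) dot (E i) w.
Proof. exact: linear_sumlz. Qed.

Lemma dot_sumr (I : Type) (r : seq I) (Q : pred I) (E : I -> M) w :
  dot w (\sum_(i <- r | Q i) E i) = \sum_(i <- r | Q i) dot w (E i).
Proof. by rewrite dotC dot_suml; apply: eq_bigr => i _; rewrite dotC. Qed.

Context (hdot : is_inner_product dot).

Lemma sqr_normB u v : `|u - v| ^+ 2 = `|u| ^+ 2 - 2 * dot u v + `|v| ^+ 2.
Proof. rewrite !hdot dotB !dotBr (dotC _ v u); ring. Qed.

Section Parseval.
Context (B : set M).
Context (oB : orthonormal_set dot B).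

(** Finite subsets of [B] are encoded as duplicate-free lists. For such [F], [proj u F] is the
    orthogonal projection of [u] on the span of [F], and [energy u F] is its squared norm. *)
Let fin F := uniq F /\ {in F, forall b, B b}.
Let proj u F := \sum_(b <- F) dot u b *: b.
Let energy u F := \sum_(b <- F) dot u b ^+ 2.

Let dot_proj u F b : fin F -> b \in F -> dot b (proj u F) = dot u b.
Proof.
move=> [uF FB] bF; rewrite dot_sumr (bigD1_seq b)//= big_seq_cond big1 ?addr0.
  by rewrite dotZr oB.1 ?mulr1//; exact: FB.
by move=> c /andP[cF cb]; rewrite dotZr oB.2 ?mulr0 1?eq_sym//; exact: FB.
Qed.

(** A larger projection keeps the coefficients of [u] along [F]. The squared norm of a projection
    and the squared distance between nested projections both follow. *)
Let dot_projs u F F' : fin F' -> {subset F <= F'} ->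
  dot (proj u F) (proj u F') = energy u F.
Proof.
move=> finF' FF'; rewrite dot_suml; apply: eq_big_seq => b bF.
by rewrite dotZl dot_proj ?FF'.
Qed.

Let sqr_proj u F : fin F -> `|proj u F| ^+ 2 = energy u F.
Proof. by move=> finF; rewrite hdot dot_projs. Qed.

Let dist_proj u F F' : fin F -> fin F' -> {subset F <= F'} ->
  `|proj u F' - proj u F| ^+ 2 = energy u F' - energy u F.
Proof.
by move=> fF fF' FF'; rewrite sqr_normB dotC dot_projs// !sqr_proj//; ring.
Qed.

Let dist_proj_tot u F : fin F -> `|u - proj u F| ^+ 2 = `|u| ^+ 2 - energy u F.
Proof.
move=> fF; rewrite sqr_normB sqr_proj// dot_sumr.
rewrite (eq_bigr (fun b => dot u b ^+ 2)) => [|b _]; last by rewrite dotZr expr2.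
rewrite -/(energy u F); ring.
Qed.

Let bessel u F : fin F -> energy u F <= `|u| ^+ 2.
Proof. by move=> fF; rewrite -subr_ge0 -dist_proj_tot// sqr_ge0. Qed.

Let abs_dot_le u b : B b -> `|dot u b| <= `|u|.
Proof.
move=> Bb; rewrite -ler_sqr ?nnegrE// real_normK ?num_real//.
have fb : fin [:: b] by split=> // c; rewrite inE => /eqP ->.
by have := bessel u fb; rewrite /energy big_seq1.
Qed.

Let join F F' : fin F -> fin F' ->
  exists2 F'', fin F'' & {subset F <= F''} /\ {subset F' <= F''}.
Proof.
move=> [uF BF] [uF' BF']; exists (undup (F ++ F')).
  split=> [|b]; first exact: undup_uniq.
  by rewrite mem_undup mem_cat => /orP[/BF|/BF'].
by split=> b bF; rewrite mem_undup mem_cat bF ?orbT.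
Qed.

Context (totB : forall u, (forall b, B b -> dot u b = 0) -> u = 0).

(** Bessel's inequality bounds the energies, so they have a supremum; an [F] within [e] of it
    works. *)
Let energy_approx u (e : R) : 0 < e ->
  exists2 F, fin F & forall F', fin F' -> {subset F <= F'} ->
    energy u F' - energy u F < e.
Proof.
pose E := [set energy u F | F in fin].
have supE : has_sup E.
  split; first by exists (energy u [::]), [::].
  by exists (`|u| ^+ 2) => _ [F fF <-]; exact: bessel.
move=> e0; have [_ [F fF <-] lt] := sup_adherent e0 supE.
exists F => // F' fF' _; rewrite ltrBlDl -ltrBlDr.
by apply: le_lt_trans lt; rewrite lerD2r; apply: ub_le_sup; [exact: supE.2|exists F'].
Qed.

(* The expansions over finite subsets of [B], directed by inclusion, form a
   Cauchy filter whose limit has the same coefficients as [u]. *)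
Let proj_approx u (e : R) : 0 < e -> exists2 F, fin F & `|u - proj u F| < e.
Proof.
pose Phi : set_system M := [set A | exists2 F, fin F &
  forall F', fin F' -> {subset F <= F'} -> A (proj u F')].
have PhiF : ProperFilter Phi.
  split.
    by move=> [F fF /(_ F fF)]; exact.
  split.
  - by exists [::].
  - move=> A A' [F fF AF] [F' fF' AF']; have [F'' fF'' [FF'' F'F'']] := join fF fF'.
    exists F'' => // F3 fF3 F''F3; split; [apply: AF|apply: AF'] => // b bF.
      exact/F''F3/FF''.
    exact/F''F3/F'F''.
  - move=> A A' AA' [F fF AF]; exists F => // F' fF' FF'; exact/AA'/AF.
have cPhi : cvg Phi.
  apply: cauchy_cvg; apply: cauchy_exP => /= e' e0.
  (* Squared distances between nested projections are energy increments, hence the tolerance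
     [e' ^+ 2]. *)
  have [F fF HF] := energy_approx u (exprn_gt0 2 e0).
  exists (proj u F), F => // F' fF' FF'; rewrite -ball_normE/=.
  rewrite distrC -ltr_sqr ?nnegrE ?(ltW e0)// dist_proj//.
  exact: HF.
have lim_approx (e' : R) : 0 < e' -> exists2 F, fin F &
    forall F', fin F' -> {subset F <= F'} -> `|lim Phi - proj u F'| < e'.
  by move=> e0; have /fcvgrPdist_lt/(_ _ e0) := cPhi.
suff limE : lim Phi = u.
  move=> e0; have [F fF HF] := lim_approx _ e0.
  by exists F => //; rewrite -{1}limE; exact: HF.
apply/eqP; rewrite -subr_eq0; apply/eqP/totB => b Bb.
apply/eqP; rewrite -normr_le0; apply/ler_addgt0Pr => e' e0; rewrite add0r.
have [F fF HF] := lim_approx _ e0.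
have fb : fin [:: b] by split=> // c; rewrite inE => /eqP ->.
have [F' fF' [FF' bF']] := join fF fb.
(* As [F'] contains [b], the vectors [u] and [proj u F'] have the same coefficient along [b], so the
   coefficient of [lim Phi - u] is bounded by the distance from [proj u F'] to the limit. *)
have -> : dot (lim Phi - u) b = dot (lim Phi - proj u F') b.
  by rewrite !dotB [dot (proj _ _) _]dotC dot_proj// bF'// mem_head.
exact: le_trans (abs_dot_le _ Bb) (ltW (HF _ fF' FF')).
Qed.

(** Bessel's inequality bounds every finite partial sum by the right-hand side, and totality of [B]
    makes some partial sum come arbitrarily close to it. *)
Lemma parseval u : (\esum_(b in B) (dot u b ^+ 2)%:E = (`|u| ^+ 2)%:E)%E.
Proof.
have fsumE F : fin F -> (\sum_(b \in [set` F]) (dot u b ^+ 2)%:E = (energy u F)%:E)%E.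
  by move=> [uF _]; rewrite -fsbig_seq// sumEFin.
apply/eqP; rewrite eq_le; apply/andP; split.
  apply: ge_ereal_sup => _ [A [/finite_seqP[s ->] AB] <-].
  have eqs : [set` s] = [set` undup s].
    by apply/seteqP; split=> b /=; rewrite mem_undup.
  have fs : fin (undup s).
    split=> [|b]; first exact: undup_uniq.
    by rewrite mem_undup => /AB.
  by rewrite eqs fsumE// lee_fin bessel.
apply/lee_addgt0Pr => e e0.
(* The energy defect is the square of the distance to the projection, hence the square root. *)
have se0 : 0 < Num.sqrt e by rewrite sqrtr_gt0.
have [F fF uF] := proj_approx u se0.
have : `|u| ^+ 2 - energy u F < e.
  by rewrite -dist_proj_tot// -[ltRHS](sqr_sqrtr (ltW e0)) ltr_sqr ?nnegrE ?(ltW se0).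
rewrite ltrBlDr addrC => /ltW uFe.
apply: (@le_trans _ _ (energy u F + e)%:E); first by rewrite lee_fin.
rewrite EFinD; apply: leeD => //; rewrite -fsumE//; apply: ereal_sup_ubound.
by exists [set` F] => //; split; [exact: finite_seq|exact: fF.2].
Qed.

End Parseval.
End InnerProductTheory.

(** The diagonal entries are sums of squares, so the negative part vanishes and the finite sum
    commutes with the sum over the basis; Parseval then evaluates each [v i], whatever the basis. *)
Lemma has_trace_sum_rank_one (R : realType) (M : completeNormedModType R)
    (dot : {dot M for idfun}) n (v : 'I_n -> M) (C : M -> M) :
  is_inner_product dot -> (forall u, C u = \sum_i dot (v i) u *: v i) ->
  has_trace dot C (\sum_i `|v i| ^+ 2).
Proof.
move=> hdot CE B [oB totB] a.
have aE b : a b = (\sum_(i < n) (dot (v i) b ^+ 2)%:E)%E.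
  by rewrite /a CE dot_suml -sumEFin; apply: eq_bigr => i _; rewrite dotZl expr2.
have a0 b : (0 <= a b)%E.
  by rewrite aE; apply: sume_ge0 => i _; rewrite lee_fin sqr_ge0.
have sa : (\esum_(b in B) a b = (\sum_i `|v i| ^+ 2)%:E)%E.
  under eq_esum do rewrite aE.
  rewrite esum_sum; last by move=> b i _ _; rewrite lee_fin sqr_ge0.
  rewrite -sumEFin; apply: eq_bigr => i _; exact: parseval.
split.
  rewrite /summable (eq_esum (b := a)) => [|b _]; last by rewrite gee0_abs.
  by rewrite sa ltry.
rewrite (eq_esum (a := (a^\+)%E) (b := a)) => [|b _]; last first.
  by rewrite funeposE; exact/max_idPl.
rewrite (esum1 (a := (a^\-)%E)) ?sube0// => b _.
by rewrite funenegE; apply/max_idPr; rewrite oppe_le0.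
Qed.

(** Turns a bare linearity hypothesis into a bundled linear map, to which the generic lemmas on
    linear maps apply. *)
Lemma linear_pack (R : pzRingType) (U V : lmodType R) (f : U -> V) :
  linear f -> exists g : {linear U -> V}, f = g.
Proof.
move=> hf; pose g : {linear U -> V} := HB.pack f (GRing.isLinear.Build R U V _ f hf).
by exists g.
Qed.

(** * The diagonal noise covariance and its weighted inner product *)

Section NoiseCovariance.
Context {R : realType} {n : nat} (sigma : 'I_n -> R).
Context (hsigma : forall i, 0 < sigma i).
Notation S := (noise_cov sigma).

Lemma invmx_noise_cov : invmx S = diag_mx (\row_i (sigma i ^+ 2)^-1).
Proof.
have SK : S *m diag_mx (\row_i (sigma i ^+ 2)^-1) = 1%:M.
  rewrite mulmx_diag -diag_const_mx; congr diag_mx; apply/rowP => i.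
  by rewrite !mxE mulfV// expf_neq0// gt_eqF.
have [uS _] := mulmx1_unit SK.
by rewrite -[RHS](mulKmx uS) SK mulmx1.
Qed.

Lemma tr_noise_cov : S^T = S.
Proof. exact: tr_diag_mx. Qed.

Lemma mulmx_noise_cov (a b : 'cV[R]_n) :
  (a^T *m S *m b) 0 0 = \sum_i sigma i ^+ 2 * (a i 0 * b i 0).
Proof.
rewrite mxE; apply: eq_bigr => i _; rewrite mul_mx_diag !mxE; ring.
Qed.

Lemma noise_cov_ge0 (a : 'cV[R]_n) : 0 <= (a^T *m S *m a) 0 0.
Proof.
rewrite mulmx_noise_cov sumr_ge0// => i _.
by rewrite mulr_ge0 ?sqr_ge0// -expr2 sqr_ge0.
Qed.

(** Polar form of [sqr_wnorm], which carries the cross term in the expansion of the misfit. *)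
Definition wdot (a b : 'cV[R]_n) := (a^T *m invmx S *m b) 0 0.

Lemma wdotE a b : wdot a b = \sum_i (sigma i ^+ 2)^-1 * (a i 0 * b i 0).
Proof.
rewrite /wdot invmx_noise_cov mxE; apply: eq_bigr => i _; rewrite mul_mx_diag !mxE; ring.
Qed.

Lemma sqr_wnormE a : sqr_wnorm sigma a = wdot a a.
Proof. by []. Qed.

Lemma wdot_ge0 a : 0 <= wdot a a.
Proof.
rewrite wdotE sumr_ge0// => i _.
by rewrite mulr_ge0 ?invr_ge0 ?sqr_ge0// -expr2 sqr_ge0.
Qed.

Lemma sqr_wnormD a b :
  sqr_wnorm sigma (a + b) = sqr_wnorm sigma a + 2 * wdot b a + sqr_wnorm sigma b.
Proof.
rewrite !sqr_wnormE !wdotE mulr_sumr -!big_split/=; apply: eq_bigr => i _.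
rewrite !mxE; ring.
Qed.

Lemma sqr_wnorm_delta i : sqr_wnorm sigma (delta_mx i 0) = (sigma i ^+ 2)^-1.
Proof.
rewrite sqr_wnormE wdotE (bigD1 i)//= big1 ?addr0 => [|j /negPf ji].
  by rewrite !mxE !eqxx/= !mulr1.
by rewrite !mxE ji/= !mulr0.
Qed.

End NoiseCovariance.

(** * Minimizer of the regularized functional *)

Section Minimizer.
Context {R : realType} {M : completeNormedModType R} {n : nat}.
Context (dot : {dot M for idfun}) (G : {linear M -> 'cV[R]_n}).
Context (Gs : 'cV[R]_n -> M) (Reg : {linear M -> M}).
Context (ytilde : 'cV[R]_n) (sigma : 'I_n -> R) (alpha : R).
Context (hGs : is_adjoint dot G Gs) (hsigma : forall i, 0 < sigma i)
  (halpha : 0 < alpha) (hReg_sa : self_adjoint dot Reg)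
  (hReg_pos : strictly_positive dot Reg).
Notation J := (Jhat dot G Reg ytilde sigma alpha).

(** Linearity follows from the adjoint relation alone, since the inner product separates points. *)
Lemma linear_adjoint : linear Gs.
Proof.
move=> a x y; apply: (@dot_inj _ _ dot) => w.
rewrite !(dotC dot _ w) dotDr dotZr !hGs mulmxDr -scalemxAr !mxE//.
Qed.

(* Stationarity at [m0] cancels the first-order term of this exact expansion. *)
Lemma Jhat_normal_equation t m0 h :
  normal_operator G Reg sigma alpha Gs m0 =
    Gs (invmx (noise_cov sigma) *m data ytilde t) ->
  J t (m0 + h) = J t m0 +
    (2^-1 * sqr_wnorm sigma (G h) + alpha / 2 * dot h (Reg h)).
Proof.
move=> eqn.
have := congr1 (dot h) eqn.
rewrite /normal_operator dotDr dotZr !hGs !mulmxA -!/(wdot sigma _ _).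
move=> stat.
rewrite /Jhat raddfD/= addrAC (sqr_wnormD hsigma (G m0 - _)).
have -> : wdot sigma (G h) (G m0 - data ytilde t) =
    wdot sigma (G h) (G m0) - wdot sigma (G h) (data ytilde t).
  by rewrite /wdot mulmxBr !mxE.
rewrite -stat (raddfD Reg)/= !dotDr !dotDl.
(* Self-adjointness merges the two cross terms of the regularization. *)
have -> : dot m0 (Reg h) = dot h (Reg m0) by rewrite -hReg_sa dotC.
by field.
Qed.

(** Strict positivity of [Reg] makes the second-order term positive for [h != 0], so every point
    other than [m0] has a strictly larger value. *)
Lemma minimizer_normal_equation t m0 m :
  normal_operator G Reg sigma alpha Gs m0 =
    Gs (invmx (noise_cov sigma) *m data ytilde t) ->
  is_minimizer (J t) m <-> m = m0.
Proof.
move=> eqn.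
have ge h : h != 0 ->
    0 < 2^-1 * sqr_wnorm sigma (G h) + alpha / 2 * dot h (Reg h).
  move=> h0; rewrite ltr_wpDl//.
    by rewrite mulr_ge0 ?invr_ge0// wdot_ge0.
  by rewrite mulr_gt0 ?divr_gt0// hReg_pos.
split=> [mmin|-> m'].
  apply/eqP; rewrite -subr_eq0; apply: contraT => /ge lt0.
  have := mmin m0; rewrite -{1}(subrKC m0 m) (Jhat_normal_equation _ eqn).
  by rewrite gerDl leNgt lt0.
have [->//|] := eqVneq m' m0; rewrite -subr_eq0 => /ge/ltW ge0.
by rewrite -[in leRHS](subrKC m0 m') (Jhat_normal_equation _ eqn) lerDl.
Qed.

Context (hH : boundedly_invertible (normal_operator G Reg sigma alpha Gs)).

Lemma minimizer_affine : exists (m0 : M) (d : 'I_n -> M),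
  forall t m, is_minimizer (J t) m <-> m = m0 + \sum_i t i 0 *: d i.
Proof.
have [K0 [[hK _] _ KA]] := hH.
have [K K0E] := linear_pack hK; rewrite {}K0E in KA.
have [Gl GlE] := linear_pack linear_adjoint.
(* With [K] the inverse of the Hessian, [m0] is the minimizer for the data [ytilde]. The [i]-th
   parameter moves the data by [ytilde i 0] along the [i]-th unit vector, and the inverse covariance
   divides this by [sigma i ^+ 2]. *)
exists (K (Gs (invmx (noise_cov sigma) *m ytilde))).
exists (fun i => (ytilde i 0 / sigma i ^+ 2) *: K (Gs (delta_mx i 0))) => t m.
have -> : K (Gs (invmx (noise_cov sigma) *m ytilde)) +
    \sum_i t i 0 *: ((ytilde i 0 / sigma i ^+ 2) *: K (Gs (delta_mx i 0))) =
    K (Gs (invmx (noise_cov sigma) *m data ytilde t)).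
  rewrite GlE.
  have -> : invmx (noise_cov sigma) *m data ytilde t =
      invmx (noise_cov sigma) *m ytilde +
      \sum_i (t i 0 * (ytilde i 0 / sigma i ^+ 2)) *: delta_mx i 0.
    apply/colP => i; rewrite [RHS]mxE summxE (bigD1 i)//= big1 ?addr0 => [|j /negPf ji].
      rewrite invmx_noise_cov// !mul_diag_mx !mxE !eqxx/=; ring.
    by rewrite !mxE eq_sym ji mulr0.
  rewrite (linearD Gl) (linearD K) (linear_sum Gl) (linear_sum K)/=.
  congr (_ + _); apply: eq_bigr => i _.
  by rewrite [in RHS]linearZ [in RHS]linearZ/= scalerA.
by apply: minimizer_normal_equation; rewrite KA.
Qed.

End Minimizer.

(** Although [M] may be infinite dimensional, the linear part is a finite sum of continuous
    coordinates times fixed vectors; being continuous, it is its own derivative. *)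
Lemma is_diff_affine (R : realType) (M : normedModType R) n (m0 : M)
    (d : 'I_n -> M) (t : 'cV[R]_n) :
  is_diff t (fun s : 'cV[R]_n => m0 + \sum_i s i 0 *: d i)
    (fun h => \sum_i h i 0 *: d i).
Proof.
pose L (h : 'cV[R]_n) : M := \sum_i h i 0 *: d i.
have cL : continuous L.
  apply: continuous_big => [|i _ x]; first exact: add_continuous.
  exact: (continuousZr_tmp (@coord_continuous R n 1 i 0 x)).
have [g gE] : exists g : {linear 'cV[R]_n -> M}, L = g.
  apply: linear_pack => a x y; rewrite /L scaler_sumr -big_split/=.
  by apply: eq_bigr => i _; rewrite !mxE scalerDl scalerA.
have dL : is_diff t L L.
  by rewrite gE in cL *; apply: DiffDef; [exact: linear_differentiable|exact: diff_lin].
by have := is_diffD (is_diff_cst m0 t) dL; rewrite add0r.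
Qed.

(** * Mean and covariance of an affine function of the noise *)

Section CovarianceAffine.
Context {R : realType} {M : completeNormedModType R} (dot : {dot M for idfun}).
Context {d : measure_display} {Omega : measurableType d} (P : probability Omega R).
Context (n : nat) (theta : Omega -> 'cV[R]_n) (sigma : 'I_n -> R).
Context (m0 : M) (v : 'I_n -> M).
Context (htheta : multivariate_normal P theta 0 (noise_cov sigma)).

Local Notation X := (fun w => m0 + \sum_i theta w i 0 *: v i).
(** Coefficients of the linear form in the noise obtained by pairing the centred variable with [u];
    weak moments in [M] thus become moments of Gaussian forms. *)
Let a u : 'cV[R]_n := \col_i dot (v i) u.

Let dotX u w : dot (m0 + \sum_i theta w i 0 *: v i - m0) u = ((a u)^T *m theta w) 0 0.
Proof.
rewrite addrC addKr dot_suml mxE; apply: eq_bigr => i _.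
by rewrite dotZl !mxE mulrC.
Qed.

Lemma is_mean_affine : is_mean P dot X m0.
Proof.
move=> u.
have XE : (fun w => (dot (X w) u)%:E) =
    (cst (dot m0 u)%:E \+ (fun w => (((a u)^T *m theta w) 0 0)%:E))%E.
  by apply/funext => w /=; rewrite -dotX dotB -EFinD subrKC.
have i0 : P.-integrable setT (cst (dot m0 u)%:E : Omega -> \bar R).
  exact: finite_measure_integrable_cst.
have i1 := integrable_normal_form htheta (noise_cov_ge0 _) (a u).
rewrite expectation.unlock XE; split; first exact: integrableD.
rewrite integralD//= (expectation_normal_form htheta (noise_cov_ge0 _)) adde0.
by rewrite integral_cst//= probability_setT mule1.
Qed.

(** The covariance of the forms [a x] and [a y] is a single sum because the noise covariance is
    diagonal; each weight [sigma i ^+ 2] is split evenly between the two factors [v i]. *)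
Lemma is_covariance_affine (C : M -> M) :
  (forall u, C u = \sum_i dot (sigma i *: v i) u *: (sigma i *: v i)) ->
  is_covariance P dot X C.
Proof.
move=> CE; exists m0; first exact: is_mean_affine.
move=> x y f.
have fE : f = fun w => ((a x)^T *m theta w) 0 0 * ((a y)^T *m theta w) 0 0.
  by apply/funext => w; rewrite /f !dotX.
rewrite expectation.unlock fE; split.
  exact: (integrable_mul_normal_form htheta (noise_cov_ge0 _)).
rewrite (expectation_mul_normal_form htheta (noise_cov_ge0 _))//; last first.
  exact: tr_noise_cov.
rewrite mulmx_noise_cov CE dot_suml; congr EFin; apply: eq_bigr => i _.
rewrite !mxE !dotZl; ring.
Qed.

End CovarianceAffine.

(** * Sensitivity indices and the trace of the covariance *)

Unset Implicit Arguments.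
Set Strict Implicit.

Theorem proposition3p1
  (R : realType) (M : completeNormedModType R) (dot : {dot M for idfun})
  (n : nat) (G : M -> 'cV[R]_n) (Gs : 'cV[R]_n -> M)
  (ytilde : 'cV[R]_n) (sigma : 'I_n -> R) (alpha : R) (Reg : M -> M)
  (d : measure_display) (Omega : measurableType d) (P : probability Omega R)
  (theta : Omega -> 'cV[R]_n)
  (hdot : is_inner_product dot)
  (hG : bounded_linear G)
  (hGs : is_adjoint dot G Gs)
  (hsigma : forall i, 0 < sigma i)
  (halpha : 0 < alpha)
  (hReg_lin : linear Reg)
  (hReg_sa : self_adjoint dot Reg)
  (hReg_pos : strictly_positive dot Reg)
  (hH : boundedly_invertible (normal_operator G Reg sigma alpha Gs))
  (htheta : multivariate_normal P theta 0 (noise_cov sigma)) :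
  let J := Jhat dot G Reg ytilde sigma alpha in
  let m_ := mstar dot G Reg ytilde sigma alpha in
  let S := sensitivity_index dot G Reg ytilde sigma alpha in
  [/\ forall t m, is_minimizer (J t) m <-> m = m_ t,
      differentiable m_ 0 &
      exists C : {linear M -> M},
        is_covariance P dot (m_ \o theta) C /\
        has_trace dot C (\sum_(i < n) S i ^+ 2)].
move=> J m_ S0.
have [Gl GE] := linear_pack hG.1; subst G.
have [Rl RE] := linear_pack hReg_lin; subst Reg.
have [m0 [dm minE]] := minimizer_affine ytilde hGs hsigma halpha hReg_sa hReg_pos hH.
have m_E t : m_ t = m0 + \sum_i t i 0 *: dm i.
  have /minE mt : is_minimizer (J t) (m0 + \sum_i t i 0 *: dm i) by exact/minE.
  (* [argmin] is a choice with a default value, so existence of a minimizer must be supplied before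
     [m_ t] is known to be one. *)
  by apply/minE; apply: getPex; exists (m0 + \sum_i t i 0 *: dm i); exact/minE.
have m_fun : m_ = (fun t => m0 + \sum_i t i 0 *: dm i) by exact/funext.
have dm_ : is_diff 0 m_ (fun h : 'cV[R]_n => \sum_i h i 0 *: dm i).
  by rewrite m_fun; exact: is_diff_affine.
have sensE i : sensitivity dot Gl Rl ytilde sigma alpha (delta_mx i 0) = dm i.
  rewrite /sensitivity -/m_ diff_val (bigD1 i)//= big1 ?addr0 => [|j /negPf ji].
    by rewrite !mxE !eqxx scale1r.
  by rewrite !mxE ji scale0r.
(* The [i]-th unit vector has weighted norm [(sigma i)^-1], so dividing by it multiplies by
   [sigma i]. *)
have S0E i : S0 i ^+ 2 = `|sigma i *: dm i| ^+ 2.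
  rewrite /S0 /sensitivity_index sensE (sqr_wnorm_delta hsigma).
  by rewrite (sqrtrV (sqr_ge0 _)) sqrtr_sqr invrK normrZ mulrC.
split.
- by move=> t m; rewrite m_E; exact: minE.
- exact: ex_diff.
have [C CE] : exists C : {linear M -> M},
    (fun u => \sum_i dot (sigma i *: dm i) u *: (sigma i *: dm i)) = C.
  apply: linear_pack => b u w; rewrite scaler_sumr -big_split/=.
  by apply: eq_bigr => i _; rewrite dotDr dotZr scalerDl -[in LHS]scalerA.
exists C; split.
  rewrite (_ : m_ \o theta = fun w => m0 + \sum_i theta w i 0 *: dm i).
    by apply: (is_covariance_affine m0 htheta) => u; rewrite -CE.
  by apply/funext => w /=; rewrite m_E.
have -> : \sum_(i < n) S0 i ^+ 2 = \sum_(i < n) `|sigma i *: dm i| ^+ 2.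
  by apply: eq_bigr => i _; exact: S0E.
refine (has_trace_sum_rank_one (v := fun i => sigma i *: dm i) hdot _).
by move=> u; rewrite -CE.
Qed.
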